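(* Let $f:\mathbb{R}^n\to\mathbb{R}^n$ and $h:\mathbb{R}^n\to\mathbb{R}^m$. Assume the system $\dot x=f(x)$, $y=h(x)$ is forward complete and that there exist a $C^1$ symmetric covariant two-tensor $P:\mathbb{R}^n\to\mathbb{R}^{n\times n}$, strictly positive real numbers $\underline{p}$, $\overline{p}$ and $\varepsilon$, and a continuous function $\rho:\mathbb{R}^n\to\mathbb{R}$ such that $$\mathcal{L}_fP(x)\le\rho(x)\,\frac{\partial h}{\partial x}(x)^\top\frac{\partial h}{\partial x}(x)-\frac{\varepsilon}{2}P(x)\qquad\forall x\in\mathbb{R}^n$$ and $$0<\underline{p}\,I\le P(x)\le\overline{p}\,I\qquad\forall x\in\mathbb{R}^n .$$ For $x\in\mathbb{R}^n$, let $t\mapsto X(x,t)$ be the solution of $\dot x=f(x)$ issued from $x$ and, for $t\ge0$, let $$A_x(t)=\frac{\partial f}{\partial x}(X(x,t)),\qquad C_x(t)=\frac{\partial h}{\partial x}(X(x,t)).$$ Then, for each $x\in\mathbb{R}^n$, there exists a continuous function $t\in[0,+\infty)\mapsto K_x(t)\in\mathbb{R}^{n\times m}$ (not required to be bounded) such that the origin of the linear time-varying system $$\dot\xi=\big(A_x(t)-K_x(t)C_x(t)\big)\xi$$ is uniformly exponentially stable.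
   Context: Standing assumption: $f,h$ are differentiable sufficiently many times. Forward complete means each solution exists on $[0,+\infty)$. The Lie derivative $\mathcal{L}_fP(x)$ is the symmetric matrix such that, for all $v\in\mathbb{R}^n$, $$v^\top\mathcal{L}_fP(x)v=\frac{\partial}{\partial x}\big(v^\top P(x)v\big)f(x)+2\,v^\top P(x)\frac{\partial f}{\partial x}(x)v .$$ Inequalities between symmetric matrices are in the sense of quadratic forms. Uniform exponential stability of the origin means that there are constants $c,\lambda>0$ such that all solutions satisfy $|\xi(t)|\le c\,e^{-\lambda(t-t_0)}|\xi(t_0)|$ for all $t\ge t_0\ge0$. *)

(* Defs.v *)
(* Points of R^n are column vectors, as in the usual matrix conventions. *)
From HB Require Import structures.
From mathcomp Require Import all_boot all_order all_algebra.
From mathcomp Require Import ring.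
From mathcomp Require Import all_classical all_reals all_analysis.

Set Implicit Arguments.
Unset Strict Implicit.
Unset Printing Implicit Defensive.

Import Order.TTheory GRing.Theory Num.Theory.
Import numFieldNormedType.Exports.

Local Open Scope classical_set_scope.
Local Open Scope ring_scope.

Section Defs.
Variable R : realType.

(* The library norm of a matrix is the sup norm. *)
Definition euclid_norm n (v : 'cV[R]_n) : R :=
  Num.sqrt (\sum_(i < n) v i 0 ^+ 2).

Definition quad_form n (A : 'M[R]_n) (v : 'cV[R]_n) : R :=
  (v^T *m A *m v) 0 0.

Definition mx_form_le n (A B : 'M[R]_n) : Prop :=
  forall v : 'cV[R]_n, quad_form A v <= quad_form B v.

(* On R^n, continuity of every directional derivative is the same as
   continuity of the differential. *)
Definition C1 n (W : normedModType R) (g : 'cV[R]_n -> W) : Prop :=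
  (forall x, differentiable g x) /\
  (forall v, continuous (fun x => 'D_v g x)).

(* The matrix (d g_i / d x_j); the library's jacobian is for row vectors and
   is the transpose of this one. *)
Definition jacobian_mx n m (g : 'cV[R]_n -> 'cV[R]_m) (x : 'cV[R]_n) :
    'M[R]_(m, n) :=
  \matrix_(i < m, j < n) ('d g x (delta_mx j 0) : 'cV[R]_m) i 0.

Definition is_lie_derivative n (f : 'cV[R]_n -> 'cV[R]_n)
    (P : 'cV[R]_n -> 'M[R]_n) (x : 'cV[R]_n) (L : 'M[R]_n) : Prop :=
  L^T = L /\
  forall v : 'cV[R]_n,
    quad_form L v = 'd (fun y => quad_form (P y) v) x (f x)
                    + 2 * (v^T *m P x *m jacobian_mx f x *m v) 0 0.

(* xget picks "the" symmetric matrix; lie_derivativeP and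
   is_lie_derivative_uniq show that it exists and is unique. *)
Definition lie_derivative n (f : 'cV[R]_n -> 'cV[R]_n)
    (P : 'cV[R]_n -> 'M[R]_n) (x : 'cV[R]_n) : 'M[R]_n :=
  xget 0 [set L | is_lie_derivative f P x L].

Lemma jacobian_mxE n m (g : 'cV[R]_n -> 'cV[R]_m) (x v : 'cV[R]_n) :
  jacobian_mx g x *m v = 'd g x v.
Proof.
apply/colP => i; rewrite mxE {2}(matrix_sum_delta v).
under [X in 'd g x X]eq_bigr do rewrite big_ord1.
rewrite linear_sum summxE; apply: eq_bigr => j _.
by rewrite linearZ !mxE mulrC.
Qed.

Lemma quad_formE n (A : 'M[R]_n) v :
  quad_form A v = \sum_(k < n) \sum_(l < n) v l 0 * A l k * v k 0.
Proof.
rewrite /quad_form mxE; apply: eq_bigr => k _; rewrite mxE mulr_suml.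
by apply: eq_bigr => l _; rewrite mxE.
Qed.

Lemma quad_form_inj n (A B : 'M[R]_n) : A^T = A -> B^T = B ->
  (forall v, quad_form A v = quad_form B v) -> A = B.
Proof.
move=> As Bs AB; apply/matrixP => i j.
have polar (C : 'M[R]_n) : C^T = C ->
    quad_form C (delta_mx i 0 + delta_mx j 0) - quad_form C (delta_mx i 0)
    - quad_form C (delta_mx j 0) = 2 * C i j.
  have e (D : 'M[R]_n) (a b : 'I_n) :
      ((delta_mx a 0 : 'cV[R]_n)^T *m D *m (delta_mx b 0 : 'cV[R]_n)) 0 0 = D a b.
    by rewrite trmx_delta -colE -rowE !mxE.
  have D0 (U V : 'M[R]_1) : (U + V) 0 0 = U 0 0 + V 0 0 by rewrite mxE.
  move=> Cs; rewrite /quad_form [(_ + _)^T]linearD/= !mulmxDl !mulmxDr.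
  rewrite !D0 !e.
  have -> : C j i = C i j by rewrite -[in LHS]Cs mxE.
  by ring.
have /(mulfI _) -> // : 2 * A i j = 2 * B i j by rewrite -!polar// !AB.
Qed.

Lemma is_lie_derivative_uniq n f (P : 'cV[R]_n -> 'M[R]_n) x L L' :
  is_lie_derivative f P x L -> is_lie_derivative f P x L' -> L = L'.
Proof.
by move=> [Ls LE] [L's L'E]; apply: quad_form_inj => // v; rewrite LE L'E.
Qed.

Lemma is_lie_derivativeE n f (P : 'cV[R]_n -> 'M[R]_n) x :
  (forall y, (P y)^T = P y) -> differentiable P x ->
  is_lie_derivative f P x
    ('d P x (f x) + P x *m jacobian_mx f x + (P x *m jacobian_mx f x)^T).
Proof.
move=> Ps dP; have dPs : ('d P x (f x))^T = 'd P x (f x).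
  rewrite -deriveE// derive_mx; last exact: diff_derivable.
  apply/matrixP => i j; rewrite !mxE; congr ('D_(f x) _ x).
  by apply/funext => y; rewrite -[in LHS]Ps mxE.
split=> [|v]; first by rewrite !linearD/= trmxK dPs addrAC.
have -> : 'd (fun y => quad_form (P y) v) x (f x) = quad_form ('d P x (f x)) v.
  have lin : linear (fun A : 'M[R]_n => quad_form A v).
    move=> a A B.
    by rewrite /quad_form mulmxDr mulmxDl -scalemxAr -scalemxAl !mxE.
  pose qM := GRing.isLinear.Build _ _ _ _ _ lin.
  pose q : {linear 'M[R]_n -> R} :=
    HB.pack (fun A : 'M[R]_n => quad_form A v) qM.
  have qc : continuous (q : 'M[R]_n -> R).
    rewrite [X in continuous X](_ : _ =
      (fun A : 'M[R]_n => \sum_(k < n) \sum_(l < n) v l 0 * A l k * v k 0)).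
      apply: continuous_big => [|k _]; first exact: add_continuous.
      apply: continuous_big => [|l _ A]; first exact: add_continuous.
      have cA := @coord_continuous R n n l k A.
      exact: (@cvgMr_tmp _ _ _ _ _ _ (v k 0) (@cvgMl_tmp _ _ _ _ _ (v l 0) _ cA)).
    by apply/funext => B; exact: quad_formE.
  have dq := linear_differentiable (P x) qc.
  rewrite [X in 'd X x](_ : _ = q \o P)// diff_comp//=.
  by rewrite (diff_lin _ qc).
rewrite /quad_form !(mulmxDr, mulmxDl) mxE [X in X + _]mxE -addrA; congr (_ + _).
rewrite mulmxA.
have -> : (v^T *m (P x *m jacobian_mx f x)^T *m v) 0 0 =
          (v^T *m (P x *m jacobian_mx f x) *m v) 0 0.
  transitivity ((v^T *m (P x *m jacobian_mx f x) *m v)^T 0 0).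
    by rewrite !trmx_mul trmxK !mulmxA.
  by rewrite mxE.
by rewrite mulmxA; ring.
Qed.

Lemma lie_derivativeP n f (P : 'cV[R]_n -> 'M[R]_n) x :
  (forall y, (P y)^T = P y) -> differentiable P x ->
  is_lie_derivative f P x (lie_derivative f P x).
Proof.
move=> Ps dP; rewrite /lie_derivative; case: xgetP => [L _ //|/(_ _)].
by move=> /(_ _ (is_lie_derivativeE f Ps dP)).
Qed.

(* Solutions of z' = F(t, z) on an interval I; z is a total function but only
   its values on I matter. Only continuity is asked at the endpoints in I:
   when F is continuous, the one-sided derivative there then exists and
   satisfies the equation. *)
Definition ode_solution n (F : R -> 'cV[R]_n -> 'cV[R]_n) (I : interval R)
    (z : R -> 'cV[R]_n) : Prop :=
  {within [set` I], continuous z} /\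
  forall t, [set` I]° t -> is_derive t 1 z (F t (z t)).

(* Every solution on some [0, T[ is the restriction of one on [0, +oo[. The
   case T = 0 says that there is a solution from every initial point. *)
Definition forward_complete n (f : 'cV[R]_n -> 'cV[R]_n) : Prop :=
  forall (T : R) (z : R -> 'cV[R]_n), 0 <= T ->
    ode_solution (fun=> f) `[0, T[ z ->
    exists2 w : R -> 'cV[R]_n, ode_solution (fun=> f) `[0, +oo[ w &
      w 0 = z 0 /\ forall t, 0 <= t < T -> w t = z t.

Definition solution_map n (f : 'cV[R]_n -> 'cV[R]_n)
    (X : 'cV[R]_n -> R -> 'cV[R]_n) : Prop :=
  forall x, X x 0 = x /\ ode_solution (fun=> f) `[0, +oo[ (X x).

Definition uniformly_exp_stable n (M : R -> 'M[R]_n) : Prop :=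
  exists c lambda : R, [/\ 0 < c, 0 < lambda &
    forall (t0 : R) (xi : R -> 'cV[R]_n), 0 <= t0 ->
      ode_solution (fun t v => M t *m v) `[t0, +oo[ xi ->
      forall t, t0 <= t ->
        euclid_norm (xi t) <=
          c * expR (- lambda * (t - t0)) * euclid_norm (xi t0)].

End Defs.

(* Main.v *)
Require Import Defs.
From HB Require Import structures.
From mathcomp Require Import all_boot all_order all_algebra.
From mathcomp Require Import ring lra.
From mathcomp Require Import all_classical all_reals all_analysis.

Set Implicit Arguments.
Unset Strict Implicit.
Unset Printing Implicit Defensive.

Import Order.TTheory GRing.Theory Num.Theory.
Import numFieldNormedType.Exports.

Local Open Scope classical_set_scope.
Local Open Scope ring_scope.

(** The idea is to use the metric [P] as a Lyapunov function along the
trajectory.  Take the gain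
  [K t = (rho (X x t) / 2) * (P (X x t))^-1 * C(t)^T]
with [C(t)] the jacobian of [h] at [X x t]; the inverse exists because [P] is
bounded below by a positive multiple of the identity.  For a solution [xi] of
the linear system put [V t = xi(t)^T P(X x t) xi(t)].  The derivative of [V] is
the value at [xi(t)] of the quadratic form [P' + P B + (P B)^T], where [B] is
the matrix of the system and [P'] the derivative of [P] in the direction [f].
Since [P K C = (rho / 2) C^T C], this form is the Lie derivative of [P] along
[f] minus [rho C^T C] ([observer_gain_lie]): the gain cancels exactly the
output term in the bound on the Lie derivative, whatever the sign or the size
of [rho].  What remains is [V' <= - (eps / 2) V], hence
[V t <= expR (- (eps / 2) * (t - t0)) * V t0]
([differential_inequality_expR]), and the two-sided bounds on [P] turn this
decay of [V] into a decay of the Euclidean norm at rate [eps / 4], with the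
constant [sqrt (pmax / pmin)] independent of [t0] ([euclid_norm_le_expR]).

Continuity of [K] holds because matrix inversion is continuous at invertible
matrices, which is read off the adjugate formula ([cvg_invmx]). *)

(** * Limits of matrix-valued functions *)

Section MatrixConvergence.
Context {R : realFieldType} {T : Type} (F : set_system T) {FF : Filter F}.

Lemma cvg_mx m n (M : T -> 'M[R]_(m, n)) (L : 'M[R]_(m, n)) :
  (forall i j, M x i j @[x --> F] --> L i j) -> M x @[x --> F] --> L.
Proof.
move=> ML; apply/cvgrPdist_le => /= e e0; near=> x.
rewrite /Num.Def.normr/= mx_normrE (bigmax_le _ (ltW e0))//= => i _.
rewrite !mxE/=; move: i; near: x; apply: filter_forall => /= i.
by have /cvgrPdist_le := ML i.1 i.2; apply.
Unshelve. all: by end_near. Qed.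

Lemma cvg_mx_coord m n (M : T -> 'M[R]_(m, n)) (L : 'M[R]_(m, n)) i j :
  M x @[x --> F] --> L -> M x i j @[x --> F] --> L i j.
Proof.
move=> ML.
exact: (cvg_comp M (fun N => N i j) ML (@coord_continuous _ _ _ i j L)).
Qed.

Lemma cvg_mulmx m n p (A : T -> 'M[R]_(m, n)) (B : T -> 'M[R]_(n, p))
    (A0 : 'M[R]_(m, n)) (B0 : 'M[R]_(n, p)) :
  A x @[x --> F] --> A0 -> B x @[x --> F] --> B0 ->
  A x *m B x @[x --> F] --> A0 *m B0.
Proof.
move=> AA0 BB0; apply: cvg_mx => i j; rewrite mxE.
under eq_fun do rewrite mxE.
apply: cvg_big => [|k _]; first exact: add_continuous.
by apply: cvgM; exact: cvg_mx_coord.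
Qed.

Lemma cvg_trmx m n (A : T -> 'M[R]_(m, n)) (A0 : 'M[R]_(m, n)) :
  A x @[x --> F] --> A0 -> (A x)^T @[x --> F] --> A0^T.
Proof.
move=> AA0; apply: cvg_mx => i j; rewrite mxE.
by under eq_fun do rewrite mxE; exact: cvg_mx_coord.
Qed.

Lemma cvg_det n (A : T -> 'M[R]_n) (A0 : 'M[R]_n) :
  A x @[x --> F] --> A0 -> \det (A x) @[x --> F] --> \det A0.
Proof.
move=> AA0; apply: cvg_big => [|s _]; first exact: add_continuous.
apply: cvgM; first exact: cvg_cst.
by apply: cvg_big => [|i _]; [exact: mul_continuous|exact: cvg_mx_coord].
Qed.

Lemma cvg_adjugate n (A : T -> 'M[R]_n) (A0 : 'M[R]_n) :
  A x @[x --> F] --> A0 -> \adj (A x) @[x --> F] --> \adj A0.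
Proof.
move=> AA0; apply: cvg_mx => i j; rewrite mxE.
under eq_fun do rewrite mxE.
apply: cvgM; first exact: cvg_cst.
apply: cvg_det; apply: cvg_mx => k l; rewrite !mxE.
by under eq_fun do rewrite !mxE; exact: cvg_mx_coord.
Qed.

(** Invertibility is only required of the limit: the determinant is then
eventually nonzero, and from there on the inverse is given by the adjugate. *)
Lemma cvg_invmx n (A : T -> 'M[R]_n) (A0 : 'M[R]_n) : A0 \in unitmx ->
  A x @[x --> F] --> A0 -> invmx (A x) @[x --> F] --> invmx A0.
Proof.
rewrite /invmx => uA0 AA0; rewrite uA0; move: uA0.
rewrite unitmxE unitfE => dA0; have dA := cvg_det AA0.
have : (\det (A x))^-1 *: \adj (A x) @[x --> F] --> (\det A0)^-1 *: \adj A0.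
  by apply: cvgZ; [exact: cvgV|exact: cvg_adjugate].
apply: cvg_trans; apply: near_eq_cvg; near=> x.
rewrite unitmxE unitfE; case: ifPn => //= /negP[].
by near: x; exact: cvgr_neq0 dA dA0.
Unshelve. all: by end_near. Qed.

End MatrixConvergence.

(** * Derivatives of matrix-valued functions *)

Section MatrixDerivatives.
Context {R : realFieldType} {V : normedModType R}.

Lemma is_derive_mxP m n (M : V -> 'M[R]_(m, n)) (x v : V) D :
  is_derive x v M D <-> forall i j, is_derive x v (fun y => M y i j) (D i j).
Proof.
split=> [MD i j|MD].
  have dM : derivable M x v by [].
  apply: DeriveDef; first by move/derivable_mxP: dM.
  by rewrite -(@derive_val _ _ _ _ _ _ _ MD) derive_mx// mxE.
have dM : derivable M x v by apply/derivable_mxP => i j.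
apply: DeriveDef => //; rewrite derive_mx//.
by apply/matrixP => i j; rewrite mxE derive_val.
Qed.

Lemma is_derive_trmx m n (A : V -> 'M[R]_(m, n)) (x v : V) dA :
  is_derive x v A dA -> is_derive x v (fun y => (A y)^T) dA^T.
Proof.
move=> /is_derive_mxP AdA; apply/is_derive_mxP => i j; rewrite mxE.
by under eq_fun do rewrite mxE.
Qed.

Lemma is_derive_mulmx m n p (A : V -> 'M[R]_(m, n)) (B : V -> 'M[R]_(n, p))
    (x v : V) dA dB :
  is_derive x v A dA -> is_derive x v B dB ->
  is_derive x v (fun y => A y *m B y) (dA *m B x + A x *m dB).
Proof.
move=> /is_derive_mxP AdA /is_derive_mxP BdB; apply/is_derive_mxP => i j.
rewrite [X in is_derive _ _ X _](_ : _ =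
    \sum_k (fun y => A y i k) * (fun y => B y k j)); last first.
  by apply/funext => y; rewrite mxE fct_sumE.
apply: is_derive_eq; rewrite !mxE -big_split; apply: eq_bigr => k _ /=.
by rewrite /GRing.scale/= addrC (mulrC (B x k j)).
Qed.

End MatrixDerivatives.

(** * Chain rule along a curve and exponential decay *)

Section Calculus.
Context {R : realType}.

Lemma is_derive_diff_comp (U W : normedModType R) (g : U -> W) (z : R -> U)
    (t : R) (dz : U) :
  differentiable g (z t) -> is_derive t 1 z dz ->
  is_derive t 1 (g \o z) ('d g (z t) dz).
Proof.
move=> dg zdz; have dzt : differentiable z t by exact/derivable1_diffP.
apply: DeriveDef; first by apply/diff_derivable/differentiable_comp.
rewrite deriveE; last exact: differentiable_comp.
by rewrite diff_comp//=; congr ('d g _ _); rewrite -deriveE// derive_val.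
Qed.

(** Comparison with the solution of [v' = - k v]: the product
[expR (k * (t - a)) * V t] has a nonpositive derivative on the open half-line,
and continuity at [a] brings the initial value into the comparison. *)
Lemma differential_inequality_expR (V : R -> R) (a k : R) :
  {within `[a, +oo[, continuous V} ->
  (forall t, a < t -> exists2 d : R, is_derive t 1 V d & d <= - k * V t) ->
  forall t, a <= t -> V t <= expR (- k * (t - a)) * V a.
Proof.
move=> Vc dV t at_.
pose W := (fun s => expR (k * (s - a))) * V.
have ed (s : R) :
    is_derive s 1 (fun s => expR (k * (s - a)) : R) (k * expR (k * (s - a))).
  have ld : is_derive s 1 (fun s => k * (s - a) : R) k.
    rewrite [X in is_derive _ _ X _](_ : _ = k *: (id - cst a))//.
    by apply: is_derive_eq; rewrite subr0 /GRing.scale/= mulr1.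
  rewrite mulrC; exact: (@is_derive1_comp _ expR _ _ _ _ (is_derive_expR _) ld).
have Wd s : a < s -> exists2 d : R, is_derive s 1 (W : R -> R) d & d <= 0.
  move=> /dV[d Vd dle]; eexists; first exact: is_deriveM.
  rewrite /GRing.scale/=.
  have := expR_ge0 (k * (s - a)); move: (expR _) => e e0.
  have := ler_wpM2l e0 dle; lra.
suff : W t <= W a.
  rewrite /W !fctE/= subrr mulr0 expR0 mul1r => le_Wa.
  by rewrite mulNr expRN -ler_pdivrMl ?invr_gt0 ?expR_gt0// invrK.
apply: (@ler0_derive1_nincry R W a _ _ _ a t (lexx a) at_).
- by move=> s; rewrite in_itv/= andbT => /Wd[d].
- move=> s; rewrite in_itv/= andbT => /Wd[d Wsd].
  by rewrite derive1E derive_val.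
move=> s; apply: cvgM; last exact: Vc.
apply: continuous_subspaceT => u.
exact/differentiable_continuous/derivable1_diffP.
Qed.

End Calculus.

(** * Quadratic forms *)

Section QuadraticForms.
Context {R : realType}.

Lemma quad_form_scalar n (a : R) (v : 'cV[R]_n) :
  quad_form a%:M v = a * \sum_(i < n) v i 0 ^+ 2.
Proof.
rewrite /quad_form mul_mx_scalar -scalemxAl !mxE; congr (_ * _).
by apply: eq_bigr => i _; rewrite mxE expr2.
Qed.

Lemma quad_formB n (A B : 'M[R]_n) v :
  quad_form (A - B) v = quad_form A v - quad_form B v.
Proof. by rewrite /quad_form mulmxBr mulmxBl !mxE. Qed.

Lemma quad_formZ n (a : R) (A : 'M[R]_n) v :
  quad_form (a *: A) v = a * quad_form A v.
Proof. by rewrite /quad_form -scalemxAr -scalemxAl mxE. Qed.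

(** A form bounded below by a positive definite one has trivial kernel. *)
Lemma form_ge_scalar_unitmx n (A : 'M[R]_n) (a : R) :
  0 < a -> mx_form_le a%:M A -> A \in unitmx.
Proof.
move=> a0 aA; rewrite -unitmx_tr -row_free_unit; apply: inj_row_free => v vA.
have := aA v^T; rewrite quad_form_scalar /quad_form trmxK -mulmxA.
rewrite -[A]trmxK -trmx_mul vA trmx0 mulmx0 mxE pmulr_rle0// => v0.
apply/rowP => i; rewrite mxE; apply/eqP; rewrite -sqrf_eq0.
rewrite eq_le sqr_ge0 andbT; apply: le_trans v0.
rewrite (bigD1 i)//= mxE lerDl.
by apply: sumr_ge0 => j _; exact: sqr_ge0.
Qed.

(** The product rule for [z^T Q z] when [z] solves a linear equation; symmetry
of [Q t] is what lets the term coming from [z^T] be written as a transpose. *)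
Lemma is_derive_quad_form n (Q : R -> 'M[R]_n) (z : R -> 'cV[R]_n) (t : R)
    (dQ B : 'M[R]_n) :
  (Q t)^T = Q t -> is_derive t 1 Q dQ -> is_derive t 1 z (B *m z t) ->
  is_derive t 1 (fun s => quad_form (Q s) (z s))
    (quad_form (dQ + Q t *m B + (Q t *m B)^T) (z t)).
Proof.
move=> Qs QdQ zdz.
have /is_derive_mxP/(_ 0 0) := is_derive_mulmx
  (is_derive_mulmx (is_derive_trmx zdz) QdQ) zdz.
move=> /is_derive_eq; apply; congr (fun_of_matrix _ 0 0).
rewrite !trmx_mul Qs !(mulmxDl, mulmxDr) !mulmxA.
by rewrite -addrA addrC.
Qed.

(** Passing from a Lyapunov function, squeezed between [a] and [b] times the
squared norm, to the norm itself; taking square roots halves the rate. *)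
Lemma euclid_norm_le_expR n (u v : 'cV[R]_n) (a b k s : R) :
  0 < a -> 0 < b ->
  a * (\sum_(i < n) u i 0 ^+ 2) <=
    expR (- k * s) * (b * \sum_(i < n) v i 0 ^+ 2) ->
  euclid_norm u <= Num.sqrt (b / a) * expR (- (k / 2) * s) * euclid_norm v.
Proof.
move=> a0 b0; rewrite /euclid_norm.
have : 0 <= \sum_(i < n) v i 0 ^+ 2.
  by apply: sumr_ge0 => i _; exact: sqr_ge0.
move: (\sum_i v i 0 ^+ 2) (\sum_i u i 0 ^+ 2) => V U V0 le_UV.
have -> : expR (- (k / 2) * s) = Num.sqrt (expR (- k * s)).
  have -> : - k * s = - (k / 2) * s + - (k / 2) * s by field.
  by rewrite expRD -expr2 sqrtr_sqr ger0_norm// expR_ge0.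
have ba0 : 0 <= b / a by exact/ltW/divr_gt0.
rewrite -mulrA -(sqrtrM _ (expR_ge0 _)) -(sqrtrM _ ba0).
apply: ler_wsqrtr; rewrite -(ler_pM2l a0); apply: le_trans le_UV _.
by rewrite le_eqVlt; apply/orP; left; apply/eqP; field; rewrite gt_eqF.
Qed.

End QuadraticForms.

(** * The observer gain *)

Lemma C1_jacobian_continuous (R : realType) n m
    (g : 'cV[R]_n -> 'cV[R]_m) :
  C1 g -> continuous (jacobian_mx g).
Proof.
move=> [gd gc] x; have FF := @nbhs_filter _ x.
refine (cvg_mx (F := nbhs x) (M := jacobian_mx g)
  (L := jacobian_mx g x) _) => i j.
rewrite [X in _ --> X]mxE.
under eq_fun do rewrite mxE -deriveE//.
rewrite -deriveE//; apply: (cvg_mx_coord (F := nbhs x)); exact: gc.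
Qed.

Section ObserverGain.
Variables (R : realType) (n m : nat).
Variables (f : 'cV[R]_n -> 'cV[R]_n) (h : 'cV[R]_n -> 'cV[R]_m).
Variables (P : 'cV[R]_n -> 'M[R]_n) (rho : 'cV[R]_n -> R).

(** The [P]-gradient of the output map, scaled so that the weighted product
[P K C] is [(rho / 2) C^T C]. *)
Definition observer_gain (x : 'cV[R]_n) : 'M[R]_(n, m) :=
  (rho x / 2) *: (invmx (P x) *m (jacobian_mx h x)^T).

Lemma continuous_observer_gain : C1 h -> C1 P -> continuous rho ->
  (forall x, P x \in unitmx) -> continuous observer_gain.
Proof.
move=> hC1 [dP _] rhoc Pu x.
have FF := @nbhs_filter _ x.
apply: (cvgZ (F := nbhs x)).
  by apply: (cvgM (F := nbhs x)); [exact: rhoc|exact: cvg_cst].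
refine (cvg_mulmx (F := nbhs x) (A := invmx \o P) _ _).
  refine (cvg_invmx (F := nbhs x) (A := P) _ _) => //.
  exact: differentiable_continuous.
refine (cvg_trmx (F := nbhs x) (A := jacobian_mx h) _).
exact: C1_jacobian_continuous.
Qed.

(** The identity that dictates the gain: it subtracts [rho C^T C] from the Lie
derivative, one half through [P K C] and one half through its transpose. *)
Lemma observer_gain_lie (x : 'cV[R]_n) :
  P x \in unitmx -> (forall y, (P y)^T = P y) -> differentiable P x ->
  let B := jacobian_mx f x - observer_gain x *m jacobian_mx h x in
  'd P x (f x) + P x *m B + (P x *m B)^T =
  lie_derivative f P x - rho x *: ((jacobian_mx h x)^T *m jacobian_mx h x).
Proof.
move=> Pu Ps dP /=.
rewrite (is_lie_derivative_uniq (lie_derivativeP f Ps dP)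
  (is_lie_derivativeE f Ps dP)).
have PK : P x *m (observer_gain x *m jacobian_mx h x) =
    (rho x / 2) *: ((jacobian_mx h x)^T *m jacobian_mx h x).
  by rewrite /observer_gain -scalemxAl -scalemxAr -mulmxA mulKVmx.
rewrite mulmxBr PK [(_ - _)^T]linearB/= [((rho x / 2) *: _)^T]linearZ/=.
rewrite [((_)^T *m jacobian_mx h x)^T]trmx_mul trmxK.
set S := (jacobian_mx h x)^T *m jacobian_mx h x.
have -> : rho x *: S = (rho x / 2) *: S + (rho x / 2) *: S.
  by rewrite -scalerDl -splitr.
by rewrite opprD !addrA; congr (_ - _); rewrite addrAC.
Qed.

End ObserverGain.

(** * Exponential stability *)

Theorem theorem2p9 (R : realType) (n m : nat)
    (f : 'cV[R]_n -> 'cV[R]_n) (h : 'cV[R]_n -> 'cV[R]_m)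
    (f_C1 : C1 f) (h_C1 : C1 h) (f_complete : forward_complete f)
    (P : 'cV[R]_n -> 'M[R]_n) (P_C1 : C1 P) (P_sym : forall x, (P x)^T = P x)
    (pmin pmax eps : R) (pmin_gt0 : 0 < pmin) (pmax_gt0 : 0 < pmax)
    (eps_gt0 : 0 < eps)
    (rho : 'cV[R]_n -> R) (rho_cont : continuous rho)
    (lieP_le : forall x,
       mx_form_le (lie_derivative f P x)
         (rho x *: ((jacobian_mx h x)^T *m jacobian_mx h x)
          - (eps / 2) *: P x))
    (P_ge : forall x, mx_form_le (pmin%:M) (P x))
    (P_le : forall x, mx_form_le (P x) (pmax%:M))
    (X : 'cV[R]_n -> R -> 'cV[R]_n) (X_sol : solution_map f X) :
  forall x : 'cV[R]_n,
    exists2 K : R -> 'M[R]_(n, m),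
      {within `[0, +oo[, continuous K} &
      uniformly_exp_stable
        (fun t => jacobian_mx f (X x t) - K t *m jacobian_mx h (X x t)).
Proof.
move=> x; have [_ [Xc Xd]] := X_sol x.
have Pu y : P y \in unitmx := form_ge_scalar_unitmx pmin_gt0 (P_ge y).
have Pd : forall y, differentiable P y by case: P_C1.
exists (observer_gain h P rho \o X x).
  apply: within_continuous_comp => // y _.
  exact: continuous_observer_gain.
exists (Num.sqrt (pmax / pmin)), (eps / 2 / 2); split.
- by rewrite sqrtr_gt0 divr_gt0.
- by rewrite !divr_gt0.
move=> t0 xi t0_ge0 [xic xid] t t0t.
pose V s := quad_form (P (X x s)) (xi s).
apply: euclid_norm_le_expR => //; rewrite -!quad_form_scalar.
apply: (le_trans (P_ge (X x t) (xi t))).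
apply: (@le_trans _ _ (expR (- (eps / 2) * (t - t0)) * V t0)); last first.
  by apply: ler_wpM2l; [exact: expR_ge0|exact: P_le].
apply: (differential_inequality_expR (V := V)) t0t => [s|s t0s].
  have FF := @nbhs_filter _ s.
  have PXc : {within `[t0, +oo[, continuous (P \o X x)}.
    apply: within_continuous_comp => [y _|].
      exact: differentiable_continuous.
    apply: continuous_subspaceW Xc => u /=; rewrite !in_itv/= !andbT.
    exact: le_trans.
  apply: (cvg_mx_coord (F := nbhs s)).
  apply: (cvg_mulmx (F := nbhs s)); last exact: xic.
  apply: (cvg_mulmx (F := nbhs s)); last exact: PXc.
  by apply: (cvg_trmx (F := nbhs s)); exact: xic.
have Xds : is_derive s 1 (X x) (f (X x s)).
  by apply: Xd; rewrite interior_itv/= in_itv/= andbT (le_lt_trans t0_ge0).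
eexists.
  apply: is_derive_quad_form => //; last first.
    by apply: xid; rewrite interior_itv/= in_itv/= andbT.
  exact: is_derive_diff_comp.
rewrite observer_gain_lie//.
have := lieP_le (X x s) (xi s).
by rewrite !(quad_formB, quad_formZ) /V => ?; lra.
Qed.
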